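(* Fix $E_{\rm c}>0$, $T>0$ and an initial vector $\Phi^0\in\mathbb{C}^{|\mathcal{I}_{E_{\rm c}}|}$. Let $H=D+V^1+V^2$ be the plane wave Hamiltonian matrix with energy cutoff $E_{\rm c}$ of the two-layer incommensurate system, and let $\Phi(t)$ be the solution of $$\frac{\mathrm{d}\Phi(t)}{\mathrm{d}t}=-iH\Phi(t),\qquad \Phi(0)=\Phi^0 .$$ For a time step $\tau>0$ let $\Phi^k$ be obtained from $\Phi^0$ by the semi-implicit scheme $$\Phi^{k+1}=(I+i\tau D)^{-1}\big(\Phi^k-i\tau V^1\Phi^k-i\tau V^2\Phi^k\big),\qquad k=0,1,2,\dots$$ Then there exist positive constants $\tau_0$ and $C_T$ (with $C_T$ depending on $T$ but independent of $\tau$) such that $$\|\Phi(t_k)-\Phi^k\|_{\ell_2}\leq C_T\,\tau$$ for any time step $0<\tau<\tau_0$ and every $t_k=k\tau\in[0,T]$.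
   Context: Let $d\in\{1,2\}$ and let $A_1,A_2\in\mathbb{R}^{d\times d}$ be invertible. For $j=1,2$ put $\mathcal{R}_j=\{A_jn:n\in\mathbb{Z}^d\}$, $\Gamma_j=\{A_j\alpha:\alpha\in[0,1)^d\}$, $\mathcal{R}_j^*=\{2\pi A_j^{-T}n:n\in\mathbb{Z}^d\}$ and $G_{jm}=2\pi A_j^{-T}m$ for $m\in\mathbb{Z}^d$. The lattices are assumed incommensurate: for $\gamma\in\mathbb{R}^d$, $\gamma+(\mathcal{R}_1^*\cup\mathcal{R}_2^* )=\mathcal{R}_1^*\cup\mathcal{R}_2^*$ if and only if $\gamma=0$. For $j=1,2$, $v_j\in L^2_{\rm loc}(\mathbb{R}^d)$ is a real-valued $\mathcal{R}_j$-periodic potential, with Fourier coefficients $\hat v^{(j)}_m=\frac{1}{|\Gamma_j|}\int_{\Gamma_j}v_j(x)e^{-iG_{jm}\cdot x}\,\mathrm{d}x$, $m\in\mathbb{Z}^d$. For an energy cutoff $E_{\rm c}>0$ let $\mathcal{I}^{j}_{E_{\rm c}}=\{m\in\mathbb{Z}^d:|G_{jm}|^2\le 2E_{\rm c}\}$ ($j=1,2$) and $\mathcal{I}_{E_{\rm c}}=\mathcal{I}^1_{E_{\rm c}}\times\mathcal{I}^2_{E_{\rm c}}$, a finite set. Vectors in $\mathbb{C}^{|\mathcal{I}_{E_{\rm c}}|}$ are indexed by $(m,n)\in\mathcal{I}_{E_{\rm c}}$. The matrices $D,V^1,V^2\in\mathbb{C}^{|\mathcal{I}_{E_{\rm c}}|\times|\mathcal{I}_{E_{\rm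 c}}|}$ have entries, for $(m,n),(m',n')\in\mathcal{I}_{E_{\rm c}}$, $$D_{mn,m'n'}=\tfrac12|G_{1m}+G_{2n}|^2\delta_{mm'}\delta_{nn'},\quad V^1_{mn,m'n'}=\hat v^{(1)}_{m-m'}\delta_{nn'},\quad V^2_{mn,m'n'}=\hat v^{(2)}_{n-n'}\delta_{mm'},$$ and $I$ is the identity matrix. The matrix $H=D+V^1+V^2$ is Hermitian. *)

(* Defs.v *)
From HB Require Import structures.
From mathcomp Require Import all_boot all_order all_algebra finmap complex.
From mathcomp Require Import all_classical all_reals all_analysis.

Set Implicit Arguments.
Unset Strict Implicit.
Unset Printing Implicit Defensive.

Import Order.TTheory GRing.Theory Num.Theory.
Import numFieldNormedType.Exports.

Local Open Scope classical_set_scope.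
Local Open Scope ring_scope.
Local Open Scope complex_scope.

(* The sigma-algebra on ['cV[T]_n] is the one generated by the coordinates
   (the Borel sets when [T] is [R]), as the library does for [n.-tuple T]. *)
Definition measure_cV_display : measure_display -> measure_display.
Proof. exact. Qed.

Section measurable_cV.
Context {d} {T : sigmaRingType d}.
Variable n : nat.

Let coors : 'I_n -> 'cV[T]_n -> T := fun i x => x i 0.

Let cV_set0 : g_sigma_preimage coors set0.
Proof. exact: sigma_algebra0. Qed.

Let cV_setC A : g_sigma_preimage coors A -> g_sigma_preimage coors (~` A).
Proof. exact: sigma_algebraC. Qed.

Let cV_bigcup (F : _^nat) : (forall i, g_sigma_preimage coors (F i)) ->
  g_sigma_preimage coors (\bigcup_i (F i)).
Proof. exact: sigma_algebra_bigcup. Qed.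

HB.instance Definition _ := @isMeasurable.Build (measure_cV_display d)
  'cV[T]_n (g_sigma_preimage coors) cV_set0 cV_setC cV_bigcup.
End measurable_cV.

Lemma measurable_cV_coord d (T : sigmaRingType d) n (i : 'I_n) :
  measurable_fun [set: 'cV[T]_n] (fun x => x i 0).
Proof.
move=> _ Y mY; rewrite setTI; apply: sub_sigma_algebra => /=.
rewrite -bigcup_seq/=; exists i => /=; first by rewrite mem_index_enum.
by exists Y => //; rewrite setTI.
Qed.

Lemma measurable_fun_cVP d1 d2 (T1 : measurableType d1) (T2 : measurableType d2)
    n (f : T1 -> 'cV[T2]_n) :
  (forall i, measurable_fun [set: T1] (fun x => f x i 0)) ->
  measurable_fun [set: T1] f.
Proof.
move=> mf _ A mA; rewrite setTI.
have : (g_sigma_preimage (fun i x => f x i 0) : set (set T1)) `<=` measurable.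
  apply: smallest_sub; first exact: sigma_algebra_measurable.
  move=> B; rewrite -bigcup_seq/= => -[i _ [C mC <-]]; exact: mf.
apply.
rewrite (@g_sigma_preimage_comp _ _ n _ (fun i (x : 'cV[T2]_n) => x i 0) _ f).
by exists A => //; rewrite setTI.
Qed.

Section lebesgue_cV.
Context {R : realType}.
Local Notation RR := (measurableTypeR R).
Local Notation leb1 := (@lebesgue_measure R).

Definition cons_cV n (p : RR * 'cV[RR]_n) : 'cV[RR]_n.+1 :=
  \col_i oapp (fun j => p.2 j 0) p.1 (unlift 0 i).

Definition uncons_cV n (x : 'cV[RR]_n.+1) : RR * 'cV[RR]_n :=
  (x 0 0, \col_j x (lift 0 j) 0).

Lemma cons_cVK n : cancel (@cons_cV n) (@uncons_cV n).
Proof.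
move=> [a x]; rewrite /uncons_cV /cons_cV mxE unlift_none /=; congr pair.
by apply/matrixP => i j; rewrite !mxE liftK ord1.
Qed.

Lemma uncons_cVK n : cancel (@uncons_cV n) (@cons_cV n).
Proof.
move=> x; apply/matrixP => i j; rewrite !mxE ord1.
by case: unliftP => [k ->|->] //=; rewrite mxE.
Qed.

Lemma measurable_cons_cV n : measurable_fun setT (@cons_cV n).
Proof.
apply: measurable_fun_cVP => i.
under eq_fun do rewrite mxE.
case: unliftP => [k _|_] /=; last exact: measurable_fst.
exact: (measurableT_comp (measurable_cV_coord k) measurable_snd).
Qed.

Lemma measurable_uncons_cV n : measurable_fun setT (@uncons_cV n).
Proof.
apply/measurable_fun_pairP; split; first exact: measurable_cV_coord.
apply: measurable_fun_cVP => i /=.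
by under eq_fun do rewrite mxE; exact: measurable_cV_coord.
Qed.

Section step.
Context n (mu : {sigma_finite_measure set 'cV[RR]_n -> \bar R}).

Definition lebesgue_cV_step : set 'cV[RR]_n.+1 -> \bar R :=
  pushforward (leb1 \x mu)%E (@cons_cV n).

Let m0 : lebesgue_cV_step set0 = 0%E.
Proof. by rewrite /lebesgue_cV_step /pushforward preimage_set0 measure0. Qed.

Let m_ge0 A : (0 <= lebesgue_cV_step A)%E.
Proof. by rewrite /lebesgue_cV_step /pushforward measure_ge0. Qed.

Let m_sigma_additive : semi_sigma_additive lebesgue_cV_step.
Proof.
exact: (@measure_semi_sigma_additive _ _ _
  (pushforward (leb1 \x mu)%E (mfun_Sub (mem_set (@measurable_cons_cV n))))).
Qed.

HB.instance Definition _ := isMeasure.Build _ _ _ lebesgue_cV_step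
  m0 m_ge0 m_sigma_additive.

Let m_sigma_finite : sigma_finite setT lebesgue_cV_step.
Proof.
have /sigma_finiteP[F [TF ndF Foo]] := sigma_finiteT leb1.
have /sigma_finiteP[G [TG ndG Goo]] := sigma_finiteT mu.
exists (fun k => @uncons_cV n @^-1` (F k `*` G k)).
  rewrite -preimage_bigcup -(_ : setT = \bigcup_k (F k `*` G k)) ?preimage_setT //.
  rewrite -setXTT TF TG predeqE => -[x y]; split.
    move=> [/= [k _ Fkx] [l _ Gly]]; exists (maxn k l) => //; split.
    - by move: x Fkx; exact/subsetPset/ndF/leq_maxl.
    - by move: y Gly; exact/subsetPset/ndG/leq_maxr.
  by move=> [k _ []/= ? ?]; split; exists k.
move=> k; have [? ?] := Foo k; have [? ?] := Goo k; split.
  rewrite -[X in measurable X]setTI; apply: measurable_uncons_cV => //.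
  exact: measurableX.
rewrite /lebesgue_cV_step /pushforward -comp_preimage.
rewrite (_ : _ \o _ = id); last by apply/funext => p /=; rewrite cons_cVK.
by rewrite preimage_id product_measure1E// lte_mul_pinfty// ge0_fin_numE.
Qed.

HB.instance Definition _ := Measure_isSigmaFinite.Build _ _ _ lebesgue_cV_step
  m_sigma_finite.

End step.

(* n-dimensional Lebesgue measure on Borel sets, as the n-fold product of
   [lebesgue_measure]; see [lebesgue_cV_box]. *)
Fixpoint lebesgue_cV n : {sigma_finite_measure set 'cV[RR]_n -> \bar R} :=
  if n is m.+1 then lebesgue_cV_step (lebesgue_cV m) else \d_ (0 : 'cV[RR]_0).


Lemma lebesgue_cV_box n (a b : 'cV[R]_n) : (forall i, a i 0 <= b i 0) ->
  lebesgue_cV n [set x : 'cV[RR]_n | forall i, a i 0 <= x i 0 < b i 0] =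
  (\prod_i (b i 0 - a i 0))%:E.
Proof.
elim: n a b => [|n IHn] a b ab.
  by rewrite big_ord0 /= diracE mem_set //= => -[].
rewrite /= /lebesgue_cV_step /pushforward.
pose a' : 'cV[R]_n := \col_j a (lift 0 j) 0.
pose b' : 'cV[R]_n := \col_j b (lift 0 j) 0.
rewrite (_ : _ @^-1` _ = `[a 0 0, b 0 0[%classic `*`
    [set x : 'cV[RR]_n | forall i, a' i 0 <= x i 0 < b' i 0]); last first.
  apply/seteqP; split => -[t x] /=.
    move=> h; split => [|i].
      by have := h 0; rewrite mxE unlift_none /= in_itv.
    by have := h (lift 0 i); rewrite !mxE liftK.
  rewrite in_itv /= => -[h0 h] i; rewrite mxE.
  by case: unliftP => [j ->|->] //=; have := h j; rewrite !mxE.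
rewrite product_measure1E; last 2 first.
- exact: measurable_itv.
- rewrite (_ : [set _ | _] = \bigcap_(i : 'I_n)
     ((fun x : 'cV[RR]_n => x i 0) @^-1` `[a' i 0, b' i 0[%classic)); last first.
    apply/seteqP; split => x /= h.
      by move=> i _ /=; rewrite in_itv /=.
    by move=> i; have := h i I; rewrite /= in_itv.
  apply: fin_bigcap_measurable => // i _.
  rewrite -[X in measurable X]setTI.
  by apply: measurable_cV_coord => //; exact: measurable_itv.
rewrite IHn => [|i]; last by rewrite !mxE.
transitivity (leb1 `[a 0%R 0%R, b 0%R 0%R[%classic *
    (\prod_i (b' i 0 - a' i 0))%R%:E)%E; first by [].
under eq_bigr do rewrite !mxE.
rewrite lebesgue_measure_itv.
rewrite /= lte_fin big_ord_recl.
rewrite -EFinB; case: ltP => [_|ba]; first by rewrite -EFinM.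
rewrite (_ : b 0 0 = a 0 0) ?subrr ?mul0r ?mul0e //.
by apply/le_anti; rewrite ba ab.
Qed.

End lebesgue_cV.

Section lattice.
Context {R : realType} {d : nat}.
Implicit Types (A : 'M[R]_d) (x y : 'cV[R]_d) (m : 'cV[int]_d) (Ec : R).

Definition dot x y : R := \sum_i x i 0 * y i 0.

Definition intv m : 'cV[R]_d := map_mx (intr : int -> R) m.

Definition lattice A : set 'cV[R]_d := [set A *m intv m | m in setT].

Definition cell A : set 'cV[R]_d :=
  [set A *m alpha | alpha in
    [set alpha : 'cV[R]_d | forall i, 0 <= alpha i 0 < 1]].

(* [invmx A^T] is A^{-T}. *)
Definition Gvec A m : 'cV[R]_d := (2 * pi) *: (invmx A^T *m intv m).

Definition reciprocal A : set 'cV[R]_d := [set Gvec A m | m in setT].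

Definition incommensurate A1 A2 : Prop :=
  forall gamma : 'cV[R]_d,
    [set gamma + g | g in reciprocal A1 `|` reciprocal A2] =
      reciprocal A1 `|` reciprocal A2 <-> gamma = 0.

(* Every class in L^2_loc has a Borel representative; [v] is one. *)
Definition L2loc (v : 'cV[R]_d -> R) : Prop :=
  measurable_fun setT v /\
  forall K : set 'cV[R]_d, compact K ->
    (\int[lebesgue_cV d]_(x in K) ((v x) ^+ 2)%:E < +oo)%E.

(* Elements of L^2_loc are classes of functions modulo null sets, hence the
   almost-everywhere equality. *)
Definition lattice_periodic A (v : 'cV[R]_d -> R) : Prop :=
  forall r, lattice A r -> {ae lebesgue_cV d, forall x, v (x + r) = v x}.

Definition expi (theta : R) : R[i] := cos theta +i* sin theta.

Definition cintegral (D : set 'cV[R]_d) (f : 'cV[R]_d -> R[i]) : R[i] :=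
  (\int[lebesgue_cV d]_(x in D) complex.Re (f x)) +i*
  (\int[lebesgue_cV d]_(x in D) complex.Im (f x)).

(* [fine (lebesgue_cV d (cell A))] is the volume of the unit cell. *)
Definition fourier A (v : 'cV[R]_d -> R) m : R[i] :=
  ((fine (lebesgue_cV d (cell A)))^-1)%:C *
  cintegral (cell A) (fun x => (v x)%:C * expi (- dot (Gvec A m) x)).

Definition cutoff A Ec : set 'cV[int]_d :=
  [set m | dot (Gvec A m) (Gvec A m) <= 2 * Ec].

(* [fset_set] returns the empty set on infinite sets: this lemma makes its use
   in [pw_index] sound. *)
Lemma finite_cutoff A Ec : A \in unitmx -> finite_set (cutoff A Ec).
Proof.
move=> uA.
have pi2 : (2 * pi : R) != 0 by rewrite mulf_neq0 ?pnatr_eq0 // gt_eqF ?pi_gt0.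
pose M : R :=
  `|(2 * pi : R)^-1| * (\sum_k \sum_j `|A j k|) * Num.sqrt (2 * Ec).
have bound m i : cutoff A Ec m -> `|(m i 0)%:~R| <= M.
  move=> mE.
  have -> : (m i 0)%:~R = ((2 * pi)^-1 *: (A^T *m Gvec A m)) i 0.
    rewrite /Gvec -scalemxAr scalerA mulVf // scale1r mulKVmx ?unitmx_tr //.
    by rewrite mxE.
  rewrite mxE normrM /M -mulrA ler_wpM2l // mxE (le_trans (ler_norm_sum _ _ _)) //.
  have hA : \sum_j `|A j i| <= \sum_k \sum_j `|A j k|.
    by rewrite [leRHS](bigD1 i) //= lerDl sumr_ge0 // => k _; rewrite sumr_ge0.
  apply: le_trans (ler_wpM2r (sqrtr_ge0 _) hA).
  rewrite mulr_suml ler_sum // => j _; rewrite normrM mxE ler_wpM2l //.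
  rewrite -sqrtr_sqr ler_wsqrtr // (le_trans _ mE) // /dot (bigD1 j) //=.
  by rewrite expr2 lerDl sumr_ge0 // => k _; rewrite -expr2 sqr_ge0.
have [N MN] : exists N : nat, M <= N%:R.
  exists (Num.bound `|M|).
  exact: le_trans (ler_norm M) (ltW (archi_boundP (normr_ge0 M))).
pose f (g : {ffun 'I_d -> 'I_(N + N).+1}) : 'cV[int]_d :=
  \col_i ((g i : nat)%:Z - N%:Z).
apply: (@sub_finite_set _ _ (f @` setT)); last exact/finite_image/finite_finset.
move=> m mE; exists [ffun i => inord (absz (m i ord0 + N%:Z)%R)] => //.
apply/matrixP => i j; rewrite mxE ffunE ?(ord1 j).
have : `|m i 0| <= N%:Z.
  by rewrite -(ler_int R) intr_norm (le_trans (bound _ _ mE)).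
rewrite ler_norml => /andP[h1 h2].
have h0 : 0 <= m i 0 + N%:Z by rewrite -lerBlDr sub0r.
rewrite inordK ?gez0_abs ?addrK ?(ord1 j) //.
by rewrite ltnS -lez_nat gez0_abs // PoszD lerD2r.
Qed.

End lattice.

Section plane_waves.
Context {R : realType} {d : nat}.
Variables (A1 A2 : 'M[R]_d) (Ec : R) (v1 v2 : 'cV[R]_d -> R).
Local Notation C := R[i].

Definition pw_index : finType :=
  (fset_set (cutoff A1 Ec) * fset_set (cutoff A2 Ec))%type.

Definition pw_dim : nat := #|{: pw_index}|.

(* Matrices indexed by [pw_index], transported to ordinals by [enum_val]. *)
Definition pw_mx (f : pw_index -> pw_index -> C) : 'M[C]_pw_dim :=
  \matrix_(k, l) f (enum_val k) (enum_val l).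

Definition pw_D : 'M[C]_pw_dim := pw_mx (fun p q =>
  let g := Gvec A1 (val p.1) + Gvec A2 (val p.2) in
  (2^-1 * dot g g)%:C * (p.1 == q.1)%:R * (p.2 == q.2)%:R).

Definition pw_V1 : 'M[C]_pw_dim := pw_mx (fun p q =>
  fourier A1 v1 (val p.1 - val q.1) * (p.2 == q.2)%:R).

Definition pw_V2 : 'M[C]_pw_dim := pw_mx (fun p q =>
  fourier A2 v2 (val p.2 - val q.2) * (p.1 == q.1)%:R).

Definition pw_H : 'M[C]_pw_dim := pw_D + pw_V1 + pw_V2.

End plane_waves.

Section evolution.
Context {R : realType} {N : nat}.
Local Notation C := R[i].

Definition l2norm (x : 'cV[C]_N) : R :=
  Num.sqrt (\sum_i ComplexField.Normc.normc (x i 0) ^+ 2).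

(* dPhi/dt = -i H Phi on [0, +oo[, entrywise with Phi' = (Re Phi)' + i (Im Phi)'.
   Phi is required to be differentiable for t > 0 and right-continuous at 0; the
   equation for the right derivative at 0 follows. Values at t < 0 are free. *)
Definition solves_schrodinger (H : 'M[C]_N) (Phi0 : 'cV[C]_N)
    (Phi : R -> 'cV[C]_N) : Prop :=
  Phi 0 = Phi0 /\
  forall i,
    let u := fun t => complex.Re (Phi t i 0) in
    let w := fun t => complex.Im (Phi t i 0) in
    [/\ derivable_oy_Rcontinuous u 0, derivable_oy_Rcontinuous w 0 &
        forall t : R, 0 < t -> derive1 u t +i* derive1 w t =
          (- 'i%C *: (H *m Phi t)) i 0].

(* [invmx] is a true inverse here: see [unitmx_semi_implicit]. *)
Definition semi_implicit_step (D V1 V2 : 'M[C]_N) (tau : R)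
    (x : 'cV[C]_N) : 'cV[C]_N :=
  invmx (1%:M + ('i%C * tau%:C) *: D) *m
    (x - ('i%C * tau%:C) *: (V1 *m x) - ('i%C * tau%:C) *: (V2 *m x)).

Definition semi_implicit (D V1 V2 : 'M[C]_N) (tau : R) (Phi0 : 'cV[C]_N)
    (k : nat) : 'cV[C]_N :=
  iter k (semi_implicit_step D V1 V2 tau) Phi0.

End evolution.

Lemma unitmx_add_scale_diag (R : realType) (I J : finType) (f : I * J -> R)
    (tau : R) :
  1%:M + ('i%C * tau%:C) *: (\matrix_(k, l < #|{: I * J}|)
    ((f (enum_val k))%:C * ((enum_val k).1 == (enum_val l).1)%:R
      * ((enum_val k).2 == (enum_val l).2)%:R)) \in unitmx.
Proof.
have -> (c : R[i]) : 1%:M + c *: (\matrix_(k, l < #|{: I * J}|)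
    ((f (enum_val k))%:C * ((enum_val k).1 == (enum_val l).1)%:R
      * ((enum_val k).2 == (enum_val l).2)%:R)) =
    diag_mx (\row_k (1 + c * (f (enum_val k))%:C)).
  apply/matrixP => k l; rewrite !mxE -(inj_eq enum_val_inj k l).
  case: (enum_val k) (enum_val l) => [a b] [a' b']; rewrite xpair_eqE /=.
  move: (_%:C) => x; case: (a == a'); case: (b == b');
    rewrite /= ?mulr1n ?mulr0n.
  - by rewrite !mulr1.
  - by rewrite !mulr0 addr0.
  - by rewrite mulr0 mul0r mulr0 addr0.
  - by rewrite !mulr0 addr0.
rewrite unitmxE det_diag unitfE; apply/prodf_neq0 => k _; rewrite mxE.
by rewrite eq_complex /= !(mul0r, mulr0, subr0, addr0) oner_eq0.
Qed.

Lemma unitmx_semi_implicit (R : realType) (d : nat) (A1 A2 : 'M[R]_d)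
    (Ec tau : R) :
  1%:M + ('i%C * tau%:C) *: pw_D A1 A2 Ec \in unitmx.
Proof.
exact: (@unitmx_add_scale_diag R (fset_set (cutoff A1 Ec))
  (fset_set (cutoff A2 Ec)) (fun p =>
  let g := Gvec A1 (val p.1) + Gvec A2 (val p.2) in 2^-1 * dot g g) tau).
Qed.

(* Main.v *)
(* On [0, T] the exact solution is continuous, hence bounded, hence Lipschitz
   by the equation, so that inserting it into the scheme leaves a residual
   r = Phi(t + tau) - Phi(t) + i tau (D Phi(t + tau) + (V1 + V2) Phi(t))
   with |r| <= Q tau^2. The errors e_k = Phi(t_k) - Phi^k satisfy
   (I + i tau D) e_(k+1) = (I - i tau (V1 + V2)) e_k + r; as D is real diagonal,
   (I + i tau D)^-1 is a contraction, whatever tau, and therefore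
   |e_(k+1)| <= (1 + tau |V1 + V2|) |e_k| + Q tau^2. Iterating, |e_k| <=
   k Q tau^2 (1 + tau |V1 + V2|)^k <= T Q exp(T |V1 + V2|) tau. *)

Require Import Defs.
From mathcomp Require Import all_boot all_order all_algebra finmap complex.
From mathcomp Require Import all_classical all_reals all_analysis.
From mathcomp Require Import ring lra.

Import Order.TTheory GRing.Theory Num.Theory.
Import numFieldNormedType.Exports.

Local Open Scope ring_scope.
Local Open Scope complex_scope.

Import ComplexField.Normc.

(** * The modulus on the complex numbers *)

Section normc.
Context {R : realType}.
Implicit Types z w : R[i].

Lemma normc_ge0 z : 0 <= normc z.
Proof. by case: z => a b; exact: sqrtr_ge0. Qed.

Lemma normc_opp z : normc (- z) = normc z.
Proof. exact: normcN. Qed.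

Lemma normcD_le z w : normc (z + w) <= normc z + normc w.
Proof. exact: (@le_normcD R z w). Qed.

Lemma normc_real (a : R) : normc a%:C = `|a|.
Proof. by rewrite /= expr0n addr0 sqrtr_sqr. Qed.

Lemma normc_i : normc ('i%C : R[i]) = 1.
Proof. by rewrite /= expr0n add0r expr1n sqrtr1. Qed.

Lemma complex_ReB z w : complex.Re (z - w) = complex.Re z - complex.Re w.
Proof. by case: z w => [a b] []. Qed.

Lemma complex_ImB z w : complex.Im (z - w) = complex.Im z - complex.Im w.
Proof. by case: z w => [a b] []. Qed.

Lemma complex_ReZ (a : R) z : complex.Re (a%:C * z) = a * complex.Re z.
Proof. by case: z => x y /=; rewrite mul0r subr0. Qed.

Lemma complex_ImZ (a : R) z : complex.Im (a%:C * z) = a * complex.Im z.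
Proof. by case: z => x y /=; rewrite mul0r addr0. Qed.

Lemma normRe_le z : `|complex.Re z| <= normc z.
Proof. by case: z => a b /=; rewrite -sqrtr_sqr ler_wsqrtr// lerDl sqr_ge0. Qed.

Lemma normIm_le z : `|complex.Im z| <= normc z.
Proof. by case: z => a b /=; rewrite -sqrtr_sqr ler_wsqrtr// lerDr sqr_ge0. Qed.

Lemma normc_le_ReIm z : normc z <= `|complex.Re z| + `|complex.Im z|.
Proof.
rewrite {1}[z]complexE (le_trans (normcD_le _ _))//.
by rewrite normcM !normc_real normc_i mul1r.
Qed.

Lemma normc_sum (I : finType) (F : I -> R[i]) :
  normc (\sum_i F i) <= \sum_i normc (F i).
Proof.
apply: (big_rec2 (fun z a => normc z <= a)) => [|i a z _ za].
  by rewrite normc0.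
by rewrite (le_trans (normcD_le _ _))// lerD2l.
Qed.

End normc.

(** * The entrywise l1 norm of complex matrices *)

Section entrywise_norm.
Context {R : realType}.

(** One norm for vectors and matrices alike: it is submultiplicative and dominates [l2norm], so all
    estimates are made in it and only the final bound returns to l2. *)
Definition enorm {m n} (M : 'M[R[i]]_(m, n)) : R := \sum_i \sum_j normc (M i j).

Lemma enorm_ge0 m n (M : 'M[R[i]]_(m, n)) : 0 <= enorm M.
Proof. by apply: sumr_ge0 => i _; apply: sumr_ge0 => j _; exact: normc_ge0. Qed.

Lemma enorm0 m n : enorm (0 : 'M[R[i]]_(m, n)) = 0.
Proof. by apply: big1 => i _; apply: big1 => j _; rewrite mxE normc0. Qed.

Lemma enormN m n (M : 'M[R[i]]_(m, n)) : enorm (- M) = enorm M.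
Proof.
by apply: eq_bigr => i _; apply: eq_bigr => j _; rewrite mxE normc_opp.
Qed.

Lemma enormD_le m n (M P : 'M[R[i]]_(m, n)) : enorm (M + P) <= enorm M + enorm P.
Proof.
rewrite -big_split ler_sum// => i _; rewrite -big_split ler_sum// => j _.
by rewrite mxE normcD_le.
Qed.

Lemma enormZ m n c (M : 'M[R[i]]_(m, n)) : enorm (c *: M) = normc c * enorm M.
Proof.
rewrite mulr_sumr; apply: eq_bigr => i _; rewrite mulr_sumr; apply: eq_bigr => j _.
by rewrite mxE normcM.
Qed.

Lemma normc_le_enorm m n (M : 'M[R[i]]_(m, n)) i j : normc (M i j) <= enorm M.
Proof.
rewrite /enorm (bigD1 i)//= (bigD1 j)//= -addrA lerDl addr_ge0//.
  by apply: sumr_ge0 => k _; exact: normc_ge0.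
by apply: sumr_ge0 => k _; apply: sumr_ge0 => l _; exact: normc_ge0.
Qed.

Lemma enormM_le m n p (M : 'M[R[i]]_(m, n)) (P : 'M[R[i]]_(n, p)) :
  enorm (M *m P) <= enorm M * enorm P.
Proof.
rewrite /enorm mulr_suml ler_sum// => i _; rewrite mulr_suml.
apply: (@le_trans _ _ (\sum_j \sum_k normc (M i k) * normc (P k j))).
  apply: ler_sum => j _; rewrite mxE (le_trans (normc_sum _ _))//.
  by apply: ler_sum => k _; rewrite normcM.
rewrite exchange_big /= ler_sum// => k _; rewrite -mulr_sumr.
rewrite ler_wpM2l ?normc_ge0// (bigD1 k)//= lerDl.
by apply: sumr_ge0 => l _; apply: sumr_ge0 => j _; exact: normc_ge0.
Qed.

Lemma enorm_cV_le n (x : 'cV[R[i]]_n) (M : R) :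
  (forall i, normc (x i 0) <= M) -> enorm x <= n%:R * M.
Proof.
move=> xM; rewrite mulr_natl -[n in leRHS]card_ord -sumr_const ler_sum// => i _.
by rewrite big_ord1.
Qed.

Lemma l2norm_le_enorm n (x : 'cV[R[i]]_n) : l2norm x <= enorm x.
Proof.
rewrite -[leRHS]ger0_norm ?enorm_ge0// -sqrtr_sqr ler_wsqrtr// expr2.
rewrite {1}/enorm mulr_suml ler_sum// => i _.
by rewrite big_ord1 expr2 ler_wpM2l ?normc_ge0// normc_le_enorm.
Qed.

(** Unconditional stability of the implicit part: each diagonal factor [1 + i tau f_i] has real part
    1, hence modulus at least 1. *)
Lemma enorm_le_id_add_idiag n (f : 'I_n -> R) (D : 'M[R[i]]_n) (tau : R)
    (x : 'cV[R[i]]_n) :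
  (forall i j, D i j = (f i)%:C * (i == j)%:R) ->
  enorm x <= enorm ((1%:M + ('i%C * tau%:C) *: D) *m x).
Proof.
move=> DE; apply: ler_sum => i _; rewrite !big_ord1.
have -> : ((1%:M + ('i%C * tau%:C) *: D) *m x) i 0 =
    (1 + 'i%C * (tau * f i)%:C) * x i 0.
  rewrite mulmxDl mul1mx mxE -scalemxAl mulrDl mul1r; congr (_ + _).
  rewrite 2!mxE (bigD1 i)//= big1 ?addr0 => [|j ji]; last first.
    by rewrite DE eq_sym (negbTE ji) mulr0 mul0r.
  by rewrite DE eqxx mulr1 rmorphM !mulrA.
rewrite normcM ler_peMl ?normc_ge0// (le_trans _ (normRe_le _))//=.
by rewrite !(mul0r, mulr0, subr0, addr0) normr1.
Qed.

End entrywise_norm.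

(** * A priori bounds on the exact solution *)

Section exact_solution.
Context {R : realType} {N : nat}.
Variables (H : 'M[R[i]]_N) (Phi0 : 'cV[R[i]]_N) (Phi : R -> 'cV[R[i]]_N).
Hypothesis Phi_sol : solves_schrodinger H Phi0 Phi.

Lemma derivable_oy_Rcontinuous_within_itv (u : R -> R) (a b : R) :
  0 <= a -> derivable_oy_Rcontinuous u 0 -> {within `[a, b], continuous u}%classic.
Proof.
move=> a0 /derivable_oy_Rcontinuous_within_itvcy; apply: continuous_subspaceW.
by move=> x /=; rewrite !in_itv/= andbT => /andP[ax _]; exact: le_trans ax.
Qed.

(** Derivability is used only inside the interval, so [a = 0], where only right continuity is given,
    is allowed. *)
Lemma derivable_oy_Rcontinuous_MVT (u : R -> R) (a b : R) : 0 <= a -> a < b ->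
  derivable_oy_Rcontinuous u 0 ->
  exists2 c, a < c < b & u b - u a = derive1 u c * (b - a).
Proof.
move=> a0 ab du.
have [x|c cab uE] := @MVT R u (derive1 u) a b ab _
  (derivable_oy_Rcontinuous_within_itv _ _ _ a0 du).
  rewrite in_itv/= => /andP[ax _]; rewrite derive1E; apply: DeriveDef => //.
  by apply: du.1; rewrite in_itv/= andbT (le_lt_trans a0).
by exists c => //; rewrite in_itv/= in cab.
Qed.

(* The mean value theorem fails for complex functions, so it is applied to the
   real and imaginary parts at two different points, hence the factor 2. *)
Lemma schrodinger_increment_le (y : 'cV[R[i]]_N) (M a b : R) :
  0 <= a -> a <= b ->
  (forall t, a <= t <= b -> enorm (- 'i%C *: (H *m Phi t) - y) <= M) ->
  enorm (Phi b - Phi a - (b - a)%:C *: y) <= N%:R * (2 * M * (b - a)).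
Proof.
move=> a0; rewrite le_eqVlt => /predU1P[<- _|ab gM].
  by rewrite !subrr mulr0 mulr0 scale0r subrr enorm0.
have ba0 : 0 <= b - a by rewrite subr_ge0 ltW.
apply: enorm_cV_le => i; rewrite (le_trans (normc_le_ReIm _))//.
have [du dw dE] := Phi_sol.2 i.
have [c cab uE] := derivable_oy_Rcontinuous_MVT _ _ _ a0 ab du.
have [e eab wE] := derivable_oy_Rcontinuous_MVT _ _ _ a0 ab dw.
have [ac cb] := andP cab; have [ae eb] := andP eab.
have /(congr1 (@complex.Re R))/= cE := dE c (le_lt_trans a0 ac).
have /(congr1 (@complex.Im R))/= eE := dE e (le_lt_trans a0 ae).
have gMi t : a < t -> t < b ->
    normc ((- 'i%C *: (H *m Phi t)) i 0 - y i 0) <= M.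
  move=> /ltW at' /ltW tb; have := gM t; rewrite at' tb => /(_ isT).
  by apply: le_trans; have := normc_le_enorm _ _ (- 'i%C *: (H *m Phi t) - y) i 0;
    rewrite !mxE.
have HR := le_trans (normRe_le _) (gMi c ac cb).
have HI := le_trans (normIm_le _) (gMi e ae eb).
have -> : 2 * M * (b - a) = M * (b - a) + M * (b - a) by ring.
rewrite !mxE !(complex_ReB, complex_ImB) complex_ReZ complex_ImZ uE wE cE eE.
rewrite -!(mulrC (b - a)) -!mulrBr -complex_ReB -complex_ImB.
by rewrite !normrM (ger0_norm ba0) lerD// ler_wpM2l.
Qed.

Lemma schrodinger_bounded (T : R) : 0 <= T ->
  exists2 B : R, 0 <= B & forall t, 0 <= t <= T -> enorm (Phi t) <= B.
Proof.
move=> T0.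
have bnd (u : R -> R) : derivable_oy_Rcontinuous u 0 ->
    exists B, forall t, 0 <= t <= T -> `|u t| <= B.
  move=> /(derivable_oy_Rcontinuous_within_itv _ 0 T (lexx _)) cu.
  have [c _ cM] := EVT_max T0 cu; have [e _ em] := EVT_min T0 cu.
  (* The maximum and the minimum may have either sign. *)
  exists (`|u c| + `|u e|) => t tT.
  have := cM t; have := em t; rewrite in_itv/= tT => /(_ isT) h1 /(_ isT) h2.
  have := ler_norm (u c); have := lerNnormlW (lexx `|u e|).
  by have := normr_ge0 (u c); have := normr_ge0 (u e); rewrite ler_norml; lra.
have bndi i : exists B, forall t, 0 <= t <= T -> normc (Phi t i 0) <= B.
  have [/bnd[Bu uB] /bnd[Bw wB] _] := Phi_sol.2 i.
  exists (Bu + Bw) => t tT.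
  by rewrite (le_trans (normc_le_ReIm _))// lerD ?uB ?wB.
have [B PB] := choice bndi.
(* The chosen bounds carry no sign information; absolute values make the sum visibly nonnegative. *)
exists (\sum_i `|B i|); first exact: sumr_ge0.
move=> t tT; apply: ler_sum => i _.
by rewrite big_ord1 (le_trans (PB i t tT))// ler_norm.
Qed.

Lemma schrodinger_lipschitz (T : R) : 0 <= T ->
  exists2 L : R, 0 <= L & forall a b : R, 0 <= a -> a <= b -> b <= T ->
    enorm (Phi b - Phi a) <= L * (b - a).
Proof.
move=> T0; have [B B0 PB] := schrodinger_bounded _ T0.
exists (N%:R * (2 * (enorm H * B))); first by rewrite !mulr_ge0 ?enorm_ge0.
move=> a b a0 ab bT.
(* With [y = 0] the increment is controlled by the size of [H Phi] alone. *)
have := schrodinger_increment_le 0 (enorm H * B) _ _ a0 ab.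
rewrite scaler0 subr0 !mulrA; apply => t /andP[at' tb].
rewrite subr0 enormZ normc_opp normc_i mul1r (le_trans (enormM_le _ _ _ _ _))//.
by rewrite ler_wpM2l ?enorm_ge0// PB// (le_trans a0)//= (le_trans tb).
Qed.

End exact_solution.

(** * Consistency, stability and convergence of the scheme *)

Section scheme.
Context {R : realType} {N : nat}.
Variables (f : 'I_N -> R) (D V1 V2 : 'M[R[i]]_N).
Hypothesis DE : forall i j, D i j = (f i)%:C * (i == j)%:R.
Hypothesis unit_implicit :
  forall tau : R, 1%:M + ('i%C * tau%:C) *: D \in unitmx.
Variables (Phi0 : 'cV[R[i]]_N) (Phi : R -> 'cV[R[i]]_N).
Hypothesis Phi_sol : solves_schrodinger (D + V1 + V2) Phi0 Phi.

(** The second power of the step needs no second derivative of [Phi]: one factor is the length of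
    the interval, the other the Lipschitz variation of the right-hand side around its frozen
    value. *)
Lemma semi_implicit_residual (T : R) : 0 <= T ->
  exists2 Q : R, 0 <= Q & forall a b : R, 0 <= a -> a <= b -> b <= T ->
    enorm (Phi b - Phi a
      + ('i%C * (b - a)%:C) *: (D *m Phi b + (V1 + V2) *m Phi a))
    <= Q * (b - a) ^+ 2.
Proof.
move=> T0; have [L L0 PL] := schrodinger_lipschitz _ _ _ Phi_sol T T0.
exists (N%:R * (2 * ((enorm D + enorm (V1 + V2)) * L))).
  by rewrite !mulr_ge0// addr_ge0 ?enorm_ge0.
move=> a b a0 ab bT.
(* The slope used by the scheme: [D] acts at the new time, the potentials at the old one. *)
pose y := - 'i%C *: (D *m Phi b + (V1 + V2) *m Phi a).
have -> : ('i%C * (b - a)%:C) *: (D *m Phi b + (V1 + V2) *m Phi a)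
    = - ((b - a)%:C *: y).
  by rewrite /y scaleNr scalerN opprK scalerA mulrC.
have -> : N%:R * (2 * ((enorm D + enorm (V1 + V2)) * L)) * (b - a) ^+ 2 =
  N%:R * (2 * ((enorm D + enorm (V1 + V2)) * (L * (b - a))) * (b - a)) by ring.
apply: (schrodinger_increment_le _ _ _ Phi_sol) => // t /andP[at' tb].
rewrite /y -scalerBr enormZ normc_opp normc_i mul1r.
have -> : (D + V1 + V2) *m Phi t - (D *m Phi b + (V1 + V2) *m Phi a) =
    - (D *m (Phi b - Phi t)) + (V1 + V2) *m (Phi t - Phi a).
  by rewrite -addrA mulmxDl !mulmxBr opprB opprD addrACA.
rewrite (le_trans (enormD_le _ _ _ _))// mulrDl enormN lerD//.
- rewrite (le_trans (enormM_le _ _ _ _ _))// ler_wpM2l ?enorm_ge0//.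
  rewrite (le_trans (PL _ _ _ _ _))// ?(le_trans a0)//.
  by rewrite ler_wpM2l// lerD2l lerN2.
- rewrite (le_trans (enormM_le _ _ _ _ _))// ler_wpM2l ?enorm_ge0//.
  rewrite (le_trans (PL _ _ _ _ _))// ?(le_trans tb)//.
  by rewrite ler_wpM2l// lerD2r.
Qed.

(** Here [p] and [q] stand for the exact solution at two consecutive times and [x] for the iterate
    at the first; the last term is the residual. *)
Lemma semi_implicit_step_error (tau : R) (x p q : 'cV[R[i]]_N) : 0 <= tau ->
  enorm (q - semi_implicit_step D V1 V2 tau x) <=
  (1 + tau * enorm (V1 + V2)) * enorm (p - x) +
  enorm (q - p + ('i%C * tau%:C) *: (D *m q + (V1 + V2) *m p)).
Proof.
move=> tau0; set c := 'i%C * tau%:C.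
rewrite (le_trans (enorm_le_id_add_idiag _ f D tau _ DE))// -/c.
rewrite mulmxBr /semi_implicit_step -/c mulKVmx ?unit_implicit//.
have -> : (1%:M + c *: D) *m q - (x - c *: (V1 *m x) - c *: (V2 *m x)) =
    (p - x) + (- c) *: ((V1 + V2) *m (p - x)) +
    (q - p + c *: (D *m q + (V1 + V2) *m p)).
  rewrite !mulmxDl mul1mx -scalemxAl !mulmxBr !scaleNr !scalerDr !scalerN.
  by apply/matrixP => i j; rewrite !mxE; ring.
rewrite (le_trans (enormD_le _ _ _ _))// lerD2r.
rewrite (le_trans (enormD_le _ _ _ _))// mulrDl mul1r lerD2l enormZ.
rewrite normc_opp normcM normc_i mul1r normc_real ger0_norm// -mulrA.
by rewrite ler_wpM2l// enormM_le.
Qed.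

Lemma semi_implicit_convergence (T : R) : 0 <= T ->
  exists2 C_T : R, 0 < C_T & forall tau : R, 0 < tau -> forall k, k%:R * tau <= T ->
    l2norm (Phi (k%:R * tau) - semi_implicit D V1 V2 tau Phi0 k) <= C_T * tau.
Proof.
move=> T0; have [Q Q0 PQ] := semi_implicit_residual _ T0.
set K := enorm (V1 + V2); have K0 : 0 <= K := enorm_ge0 _ _ _.
(* The summand 1 only ensures positivity, since [Q] may vanish. *)
exists (1 + T * Q * expR (T * K)).
  by rewrite ltr_pwDl// !mulr_ge0// expR_ge0.
move=> tau tau0 k kT; rewrite (le_trans (l2norm_le_enorm _ _))//.
have tK : 1 <= 1 + tau * K by rewrite lerDl mulr_ge0// ltW.
(* Discrete Gronwall: each of the [k] residuals is amplified at most by the full power. *)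
have err : enorm (Phi (k%:R * tau) - semi_implicit D V1 V2 tau Phi0 k) <=
    k%:R * (Q * tau ^+ 2) * (1 + tau * K) ^+ k.
  elim: k kT => [|k IHk] kT.
    by rewrite !mul0r Phi_sol.1 subrr enorm0.
  have kk : k.+1%:R * tau - k%:R * tau = tau :> R by rewrite -mulrBl -natr1; ring.
  have kS : k%:R * tau <= k.+1%:R * tau by rewrite ler_wpM2r ?ler_nat// ltW.
  have kT' : k%:R * tau <= T := le_trans kS kT.
  have k0 : 0 <= k%:R * tau by rewrite mulr_ge0// ltW.
  rewrite /= (le_trans (semi_implicit_step_error _ _ (Phi (k%:R * tau)) _
    (ltW tau0)))//.
  have := PQ _ _ k0 kS kT; rewrite kk => res.
  have -> : k.+1%:R * (Q * tau ^+ 2) * (1 + tau * K) ^+ k.+1 =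
      (1 + tau * K) * (k%:R * (Q * tau ^+ 2) * (1 + tau * K) ^+ k) +
      Q * tau ^+ 2 * (1 + tau * K) ^+ k.+1.
    by rewrite -natr1 [_ ^+ k.+1]exprS; ring.
  rewrite lerD//; first by rewrite ler_wpM2l ?IHk// (le_trans _ tK).
  (* The new residual is not yet amplified, but a factor at least 1 may be inserted. *)
  rewrite (le_trans res)// ler_peMr ?exprn_ege1//.
  by rewrite mulr_ge0// sqr_ge0.
rewrite (le_trans err)// mulrDl mul1r.
have pow_le : (1 + tau * K) ^+ k <= expR (T * K).
  apply: (@le_trans _ _ (expR (tau * K) ^+ k)).
    by rewrite lerXn2r ?nnegrE ?expR_ge0 ?expR_ge1Dx// (le_trans _ tK).
  by rewrite -expRM_natl ler_expR mulrA ler_wpM2r.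
apply: (@le_trans _ _ (T * Q * expR (T * K) * tau)); last by rewrite lerDr ltW.
(* One [tau] pairs with [k] and is absorbed by [T]; the other is the order of convergence. *)
have -> : k%:R * (Q * tau ^+ 2) * (1 + tau * K) ^+ k =
  k%:R * tau * Q * (1 + tau * K) ^+ k * tau by ring.
rewrite ler_wpM2r ?(ltW tau0)// ler_pM// ?ler_wpM2r//.
  by rewrite !mulr_ge0// ltW.
by rewrite exprn_ge0// (le_trans _ tK).
Qed.

End scheme.

(** * Application to the plane wave matrices *)

Lemma real_diag_enum_val (R : realType) (I J : finType) (f : I * J -> R)
    (k l : 'I_#|{: I * J}|) :
  (f (enum_val k))%:C * ((enum_val k).1 == (enum_val l).1)%:R
    * ((enum_val k).2 == (enum_val l).2)%:R
  = (f (enum_val k))%:C * (k == l)%:R.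
Proof. by rewrite -(inj_eq enum_val_inj k l) -mulrA -natrM mulnb. Qed.

Theorem theorem4p1 (R : realType) (d : nat) (hd : d = 1%N \/ d = 2%N)
  (A1 A2 : 'M[R]_d) (uA1 : A1 \in unitmx) (uA2 : A2 \in unitmx)
  (incomm : incommensurate A1 A2)
  (v1 v2 : 'cV[R]_d -> R)
  (v1_L2loc : L2loc v1) (v1_per : lattice_periodic A1 v1)
  (v2_L2loc : L2loc v2) (v2_per : lattice_periodic A2 v2)
  (Ec T : R) (Ec_gt0 : 0 < Ec) (T_gt0 : 0 < T)
  (Phi0 : 'cV[R[i]]_(pw_dim A1 A2 Ec))
  (Phi : R -> 'cV[R[i]]_(pw_dim A1 A2 Ec))
  (Phi_sol : solves_schrodinger (pw_H A1 A2 Ec v1 v2) Phi0 Phi) :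
  exists tau0 C_T : R, [/\ 0 < tau0, 0 < C_T &
    forall tau : R, 0 < tau < tau0 ->
    forall k : nat, k%:R * tau <= T ->
      l2norm (Phi (k%:R * tau) -
        semi_implicit (pw_D A1 A2 Ec) (pw_V1 A1 A2 Ec v1) (pw_V2 A1 A2 Ec v2)
          tau Phi0 k) <= C_T * tau].
Proof.
pose f (p : pw_index A1 A2 Ec) : R :=
  let g := Gvec A1 (val p.1) + Gvec A2 (val p.2) in 2^-1 * dot g g.
have DE k l : pw_D A1 A2 Ec k l = (f (enum_val k))%:C * (k == l)%:R.
  by rewrite mxE; exact: real_diag_enum_val f k l.
have [C_T C_T0 err] := semi_implicit_convergence (f \o enum_val) _ _ _ DE
  (unitmx_semi_implicit A1 A2 Ec) _ _ Phi_sol T (ltW T_gt0).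
(* The estimate holds for every positive step, so 1 is an arbitrary threshold. *)
by exists 1, C_T; split=> // tau /andP[tau0 _]; exact: err.
Qed.
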